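(* Let $T>0$, let $(\mathcal{P}_N)_{N\in\mathbb{N}}$ be a quasi-uniform sequence of partitions of $[0,T]$, and let $f\sim\mathcal{GP}(0,k_{l,H})$ on $[0,T]$ with $l\in\{0,1\}$ and $0<H<1$, where $k_{0,H}$ is the fractional Brownian motion kernel and $k_{1,H}$ the integrated fractional Brownian motion kernel with Hurst parameter $H$. Let $\hat{\sigma}_{\mathrm{ICV}}^2$ be the interior cross-validation estimator of the scale parameter for the Brownian motion kernel computed from the values of $f$ at the points of $\mathcal{P}_N$. Then, as $N\to\infty$, $$\mathbb{E}\,\hat{\sigma}_{\mathrm{ICV}}^2=\Theta\big(N^{1-\min\{2(l+H),4\}}\big)=\begin{cases}\Theta(N^{1-2H})&\text{if } l=0,\\ \Theta(N^{-1-2H})&\text{if } l=1.\end{cases}$$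
   Context: Partitions: for each $N\in\mathbb{N}$, $\mathcal{P}_N=(x_{N,n})_{n=1}^N\subset[0,T]$ with $0=:x_{N,0}<x_{N,1}<\dots<x_{N,N}=T$; write $x_n$ for $x_{N,n}$. With $\Delta x_{N,n}=x_{N,n+1}-x_{N,n}$, $n=0,\dots,N-1$, the sequence $(\mathcal{P}_N)$ is quasi-uniform if there is a constant $1\le C_{\mathrm{qu}}<\infty$ such that $\sup_{N\in\mathbb{N}}\frac{\max_n\Delta x_{N,n}}{\min_n\Delta x_{N,n}}=C_{\mathrm{qu}}$. $\mathcal{GP}(0,\kappa)$ denotes the Gaussian process with zero mean function and covariance function $\kappa$. For $0<H<1$, $$k_{0,H}(x,x')=\tfrac12\big(|x|^{2H}+|x'|^{2H}-|x-x'|^{2H}\big),\qquad k_{1,H}(x,x')=\int_0^x\int_0^{x'}k_{0,H}(z,z')\,\mathrm{d}z'\,\mathrm{d}z .$$ Interior cross-validation estimator: let $k(x,x')=\min(x,x')$ on $[0,T]$ (Brownian motion kernel). For $\mathbf{x}=(x_1,\dots,x_N)$ let $\mathbf{x}_{\setminus n}$ be $\mathbf{x}$ with $x_n$ removed, and define the zero-mean Gaussian process posterior mean and variance $$m_{\setminus n}(x)=k(\mathbf{x}_{\setminus n},x)^\top k(\mathbf{x}_{\setminus n},\mathbf{x}_{\setminus n})^{-1}f(\mathbf{x}_{\setminus n}),\qquad k_{\setminus n}(x)=k(x,x)-k(\mathbf{x}_{\setminus n},x)^\top k(\mathbf{x}_{\setminus n},\mathbf{x}_{\setminus n})^{-1}k(\mathbf{x}_{\setminus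 n},x),$$ where $k(\mathbf{x}_{\setminus n},x)$ is the vector of $k(x_i,x)$, $i\ne n$, $k(\mathbf{x}_{\setminus n},\mathbf{x}_{\setminus n})$ is the matrix of $k(x_i,x_j)$, $i,j\neq n$, and $f(\mathbf{x}_{\setminus n})$ is the vector of $f(x_i)$, $i\ne n$. Then (note that the terms $n=1$ and $n=N$ are excluded) $$\hat{\sigma}_{\mathrm{ICV}}^2=\frac1N\sum_{n=2}^{N-1}\frac{[f(x_n)-m_{\setminus n}(x_n)]^2}{k_{\setminus n}(x_n)}.$$ $a_N=\Theta(b_N)$ means that there are constants $0<c\le C<\infty$ with $c\,b_N\le a_N\le C\,b_N$ for all sufficiently large $N$. *)

(* Defs.v *)
From HB Require Import structures.
From mathcomp Require Import all_boot all_order all_algebra.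
From mathcomp Require Import all_classical all_reals all_analysis.

Set Implicit Arguments.
Unset Strict Implicit.
Unset Printing Implicit Defensive.
Import Order.TTheory GRing.Theory Num.Theory.
Import numFieldNormedType.Exports.
Local Open Scope classical_set_scope.
Local Open Scope ring_scope.

(* A sequence of partitions is [x : nat -> nat -> R], where [x N n] is the point
   x_{N,n} for 0 <= n <= N and 1 <= N; all other values are irrelevant. *)
Definition partition_seq (R : realType) (T : R) (x : nat -> nat -> R) : Prop :=
  forall N : nat, (0 < N)%N ->
    [/\ x N 0%N = 0, x N N = T
      & forall n : nat, (n < N)%N -> x N n < x N n.+1].

Definition spacing (R : realType) (x : nat -> nat -> R) (N n : nat) : R :=
  x N n.+1 - x N n.

(* For N >= 1 the spacing of index 0 is one of those being compared, so it is a
   neutral starting value. *)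
Definition max_spacing (R : realType) (x : nat -> nat -> R) (N : nat) : R :=
  \big[Num.max/spacing x N 0]_(n < N) spacing x N n.

Definition min_spacing (R : realType) (x : nat -> nat -> R) (N : nat) : R :=
  \big[Num.min/spacing x N 0]_(n < N) spacing x N n.

Definition quasi_uniform (R : realType) (x : nat -> nat -> R) : Prop :=
  exists2 Cqu : R, 1 <= Cqu &
    ereal_sup [set (max_spacing x N / min_spacing x N)%:E | N in [set N | (0 < N)%N]]
      = Cqu%:E.

Definition fbm_kernel (R : realType) (H x x' : R) : R :=
  2^-1 * (`|x| `^ (2 * H) + `|x'| `^ (2 * H) - `|x - x'| `^ (2 * H)).

(* Meant for 0 <= x, x'. *)
Definition ifbm_kernel (R : realType) (H x x' : R) : R :=
  \int[lebesgue_measure]_(z in `[0, x])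
    \int[lebesgue_measure]_(z' in `[0, x']) fbm_kernel H z z'.

Definition hurst_kernel (R : realType) (l : 'I_2) (H : R) : R -> R -> R :=
  if val l is 0%N then fbm_kernel H else ifbm_kernel H.

Definition bm_kernel (R : realType) (x x' : R) : R := Num.min x x'.

(* Univariate Gaussian law, point masses included.  They are treated apart
   because [normal_prob m 0] is not the Dirac mass at [m]. *)
Definition gaussian_rv (d : measure_display) (Omega : measurableType d)
    (R : realType) (P : probability Omega R) (X : Omega -> R) : Prop :=
  exists m s : R, forall A : set R, measurable A ->
    P (X @^-1` A) = if s == 0 then \d_m A else normal_prob m s A.

(* A process is Gaussian when its finite-dimensional distributions are, i.e.
   when all finite linear combinations of its values are Gaussian.  Only the
   times in [D] matter. *)
Definition gaussian_process (d : measure_display) (Omega : measurableType d)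
    (R : realType) (P : probability Omega R) (D : set R)
    (m : R -> R) (kappa : R -> R -> R) (f : R -> {RV P >-> R}) : Prop :=
  [/\ forall (n : nat) (t c : 'I_n -> R), (forall i, D (t i)) ->
        gaussian_rv P (fun w => \sum_(i < n) c i * f (t i) w),
      forall t, D t -> expectation P (f t) = (m t)%:E
    & forall s t, D s -> D t -> covariance P (f s) (f t) = (kappa s t)%:E].

Definition kernel_col (R : realType) (k : R -> R -> R) (n : nat)
    (xs : 'rV[R]_n) (y : R) : 'cV[R]_n :=
  \col_i k (xs 0 i) y.

Definition kernel_mx (R : realType) (k : R -> R -> R) (n : nat)
    (xs : 'rV[R]_n) : 'M[R]_n :=
  \matrix_(i, j) k (xs 0 i) (xs 0 j).

Definition data_col (R : realType) (f : R -> R) (n : nat)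
    (xs : 'rV[R]_n) : 'cV[R]_n :=
  \col_i f (xs 0 i).

Definition posterior_mean (R : realType) (k : R -> R -> R) (f : R -> R)
    (n : nat) (xs : 'rV[R]_n) (y : R) : R :=
  ((kernel_col k xs y)^T *m invmx (kernel_mx k xs) *m data_col f xs) 0 0.

Definition posterior_var (R : realType) (k : R -> R -> R)
    (n : nat) (xs : 'rV[R]_n) (y : R) : R :=
  k y y
  - ((kernel_col k xs y)^T *m invmx (kernel_mx k xs) *m kernel_col k xs y) 0 0.

(* Indices are 0-based: the summation range is 2, ..., N - 1 in 1-based
   numbering, and [col' i xs] is [xs] with its point of index [i] removed. *)
Definition sigma2_ICV (R : realType) (k : R -> R -> R) (f : R -> R)
    (N : nat) (xs : 'rV[R]_N) : R :=
  N%:R^-1 * \sum_(i < N | ((0 < i) && (i.+1 < N))%N)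
    (f (xs 0 i) - posterior_mean k f (col' i xs) (xs 0 i)) ^+ 2
    / posterior_var k (col' i xs) (xs 0 i).

Definition design (R : realType) (x : nat -> nat -> R) (N : nat) : 'rV[R]_N :=
  \row_(i < N) x N i.+1.

(* [=Theta_\oo] from landau compares functions into normed modules; expectations
   are extended reals, and the bounds below include their finiteness. *)
Definition ebigTheta (R : realType) (a : nat -> \bar R) (b : nat -> R) : Prop :=
  exists c C : R, [/\ 0 < c, c <= C &
    \forall N \near \oo, ((c * b N)%:E <= a N <= (C * b N)%:E)%E].

(* Main.v *)
(* For the Brownian kernel the posterior mean at an interior point t, with
   neighbours t - a and t + b, is the linear interpolant of the two neighbouring
   values, and the posterior variance is ab / (a + b).  Both covariance kernels
   have the form u(s) + u(t) + v(s) t + v(t) s + rho |s - t|^al, with al = 2H when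
   l = 0 and al = 2H + 2 when l = 1.  The interpolation residual annihilates affine
   functions, so only the last summand contributes to its variance, and with
   p = a / (a + b), q = b / (a + b) each term of the estimator has mean
   (a + b)^(al - 1) * (- 2 rho) * (p^(al - 1) + q^(al - 1) - 1).
   Quasi-uniformity makes a and b comparable to 1 / N and keeps p and q away from
   0 and 1, where the last factor is bounded and bounded away from 0. *)
Require Import Defs.
From mathcomp Require Import all_boot all_order all_algebra.
From mathcomp Require Import all_classical all_reals all_analysis.
From mathcomp Require Import zify ring lra.
Import Order.TTheory GRing.Theory Num.Theory.
Import numFieldNormedType.Exports.
Local Open Scope classical_set_scope.
Local Open Scope ring_scope.

Set Implicit Arguments.
Unset Strict Implicit.
Unset Printing Implicit Defensive.

(** * Calculus of powers of the absolute value *)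

Lemma is_derive_norm (R : realType) (u : R) : u != 0 ->
  is_derive u 1 (fun v : R => `|v|) (Num.sg u).
Proof.
move=> u0; case: (ltgtP u 0) u0 => // [u_lt0|u_gt0] _.
  rewrite ltr0_sg//; apply: (@near_eq_is_derive _ _ _ (fun v : R => - v)).
  by near=> v; rewrite ltr0_norm//; near: v; exact: lt_nbhsl.
rewrite gtr0_sg//; apply: (@near_eq_is_derive _ _ _ (fun v : R => v)).
by near=> v; rewrite gtr0_norm//; near: v; exact: lt_nbhsr.
Unshelve. all: by end_near. Qed.

Lemma is_derive_norm_powR_neq0 (R : realType) (g u : R) : u != 0 ->
  is_derive u 1 (fun v : R => `|v| `^ g) (g * `|u| `^ (g - 1) * Num.sg u).
Proof.
move=> u0; apply: (@is_derive1_comp _ (fun v => v `^ g) (fun v => `|v|)).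
  by apply: is_derive1_powR; rewrite normr_gt0.
exact: is_derive_norm.
Qed.

Lemma continuous_norm_powR (R : realType) (g : R) : 0 < g ->
  continuous (fun u : R => `|u| `^ g).
Proof.
move=> g_gt0 u; have [->|u0] := eqVneq u 0; last first.
  apply/differentiable_continuous/derivable1_diffP.
  by case: (is_derive_norm_powR_neq0 g u0).
rewrite /continuous_at normr0 powR0 ?gt_eqF//.
apply/cvgrPdist_lt => e e_gt0.
near=> z.
rewrite sub0r normrN ger0_norm ?powR_ge0//.
have -> : e = (e `^ g^-1) `^ g by rewrite -powRrM mulVf ?gt_eqF// powRr1// ltW.
rewrite gt0_ltr_powR ?nnegrE ?powR_ge0//.
by near: z; apply: (@nbhs0_lt R R); exact: powR_gt0.
Unshelve. all: by end_near. Qed.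

Lemma is_derive_norm_powR_id (R : realType) (g u : R) : 0 < g ->
  is_derive u 1 (fun v : R => `|v| `^ g * v) ((g + 1) * `|u| `^ g).
Proof.
move=> g_gt0; have [->|u0] := eqVneq u 0.
  apply/is_derive1_caratheodory; exists (fun v => `|v| `^ g); split.
  - by move=> z; rewrite !subr0 mulr0 subr0.
  - exact: continuous_norm_powR.
  - by rewrite normr0 powR0 ?gt_eqF// mulr0.
have := is_deriveM (is_derive_norm_powR_neq0 g u0) (is_derive_id u 1).
move=> D; apply: (is_derive_eq D); rewrite /GRing.scale/= mulr1.
have : `|u| * `|u| `^ (g - 1) = `|u| `^ g by rewrite mulr_powRB1.
have : Num.sg u * u = `|u| by rewrite -normrEsg.
by nra.
Qed.

(** As |v|^(g+2) is the product of |v|^g v and v, the product rule covers 0 without a case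
    distinction. *)
Lemma is_derive_norm_powR2 (R : realType) (g u : R) : 0 < g ->
  is_derive u 1 (fun v : R => `|v| `^ (g + 2)) ((g + 2) * (`|u| `^ g * u)).
Proof.
move=> g_gt0; have := is_deriveM (is_derive_norm_powR_id u g_gt0) (is_derive_id u 1).
have -> : (fun v : R => `|v| `^ g * v) * id = (fun v : R => `|v| `^ (g + 2)).
  apply/funext => v; rewrite powRD; last first.
    by apply/implyP => /eqP; lra.
  by rewrite powR_mulrn// real_normK ?num_real// expr2 mulrA.
by move=> D; apply: (is_derive_eq D); rewrite /GRing.scale/=; ring.
Qed.

(** * Closed form of the integrated fractional Brownian motion kernel *)

Lemma Rintegral_FTC (R : realType) (f F : R -> R) (b : R) : 0 < b ->
  continuous f -> (forall u : R, is_derive u 1 F (f u)) ->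
  \int[lebesgue_measure]_(u in `[0, b]) f u = F b - F 0.
Proof.
move=> b_gt0 cf dF; rewrite /Rintegral (@continuous_FTC2 _ f F)//.
- exact: continuous_subspaceT.
- have cF (u : R) : {for u, continuous F}.
    by apply/differentiable_continuous/derivable1_diffP; case: (dF u).
  split.
  + by move=> u _; case: (dF u).
  + by apply: cvg_at_right_filter; exact: cF.
  + by apply: cvg_at_left_filter; exact: cF.
- by move=> u _; rewrite derive1E; case: (dF u).
Qed.

Section ifbm.
Variables (R : realType) (H : R).
Hypothesis H_gt0 : 0 < H.
Let g := 2 * H.
Let g_gt0 : 0 < g. Proof. by rewrite mulr_gt0. Qed.

Let dP (u : R) := is_derive_norm_powR_id u g_gt0.
Let dQ (u : R) := is_derive_norm_powR2 u g_gt0.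
Let id' (u : R) := is_derive_id u (1 : R).

Lemma Rintegral_fbm_kernel (z y : R) : 0 < y ->
  \int[lebesgue_measure]_(u in `[0, y]) fbm_kernel H z u =
  2^-1 * (`|z| `^ g * y
          + (`|y| `^ g * y + `|z - y| `^ g * (z - y) - `|z| `^ g * z) / (g + 1)).
Proof.
move=> y_gt0.
(* The signed powers |u|^g u and |z - u|^g (z - u) are differentiable across 0, so the integral need
   not be split at u = z. *)
pose F (u : R) := 2^-1 * (`|z| `^ g * u
          + (`|u| `^ g * u + `|z - u| `^ g * (z - u)) / (g + 1)).
transitivity (F y - F 0); last first.
  by rewrite /F subr0 normr0 powR0 ?gt_eqF// mul0r; field; rewrite gt_eqF// addr_gt0.
apply: Rintegral_FTC => //.
- move=> u; rewrite /fbm_kernel; apply: cvgM; first exact: cvg_cst.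
  apply: cvgB; first apply: cvgD.
  + exact: cvg_cst.
  + exact: continuous_norm_powR.
  + apply: (@continuous_comp _ _ _ (fun v => z - v) (fun v => `|v| `^ (2 * H))).
      by apply: cvgB; [exact: cvg_cst|exact: cvg_id].
    exact: continuous_norm_powR.
- move=> u; rewrite /F /fbm_kernel.
  have dzu : is_derive u 1 (fun v : R => z - v) (0 - 1).
    exact: is_deriveB (is_derive_cst z u 1) (id' u).
  have dc := @is_derive1_comp R (fun v => `|v| `^ g * v) (fun v => z - v) u _ _
    (dP (z - u)) dzu.
  have := is_deriveM (is_derive_cst (2^-1 : R) u 1)
    (is_deriveD (is_deriveM (is_derive_cst (`|z| `^ g : R) u 1) (id' u))
       (is_deriveM (is_deriveD (dP u) dc) (is_derive_cst ((g + 1)^-1) u 1))).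
  move=> D; apply: (is_derive_eq D); rewrite /GRing.scale/=.
  by field; rewrite gt_eqF// addr_gt0.
Qed.

Lemma ifbm_kernelE (s t : R) : 0 < s -> 0 < t ->
  ifbm_kernel H s t =
  2^-1 * ((`|s| `^ g * s * t + `|t| `^ g * t * s) / (g + 1)
   + (`|s - t| `^ (g + 2) - `|s| `^ (g + 2) - `|t| `^ (g + 2)) / ((g + 1) * (g + 2))).
Proof.
move=> s_gt0 t_gt0; rewrite /ifbm_kernel.
under eq_Rintegral => z _ do rewrite (Rintegral_fbm_kernel _ t_gt0).
have g0 : g != 0 by rewrite gt_eqF.
have g1 : g + 1 != 0 by rewrite gt_eqF// addr_gt0.
have g2 : g + 2 != 0 by rewrite gt_eqF// addr_gt0.
(* An antiderivative of the inner integral; [F 0] contributes the term in -|t|^(g+2). *)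
pose F (u : R) := 2^-1 * (`|u| `^ g * u * t / (g + 1) + (`|t| `^ g * t * u / (g + 1) +
   (`|u - t| `^ (g + 2) - `|u| `^ (g + 2)) / ((g + 1) * (g + 2)))).
transitivity (F s - F 0); last first.
  rewrite /F sub0r normrN normr0 (powR0 g0) (powR0 g2).
  by field; rewrite g1 g2.
apply: Rintegral_FTC => //.
- have cid (u : R) : {for u, continuous (fun v : R => v)} by exact: cvg_id.
  have cut (u : R) : {for u, continuous (fun v : R => v - t)}.
    by apply: cvgB; [exact: cvg_id|exact: cvg_cst].
  move=> u; apply: cvgM; first exact: cvg_cst.
  apply: cvgD; first by apply: cvgM; [exact: continuous_norm_powR|exact: cvg_cst].
  apply: cvgM; last exact: cvg_cst.
  apply: cvgB; last by apply: cvgM; [exact: continuous_norm_powR|exact: cvg_id].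
  apply: cvgD; first exact: cvg_cst.
  apply: cvgM; last exact: cut.
  apply: (@continuous_comp _ _ _ (fun v => v - t) (fun v => `|v| `^ g)).
    exact: cut.
  exact: continuous_norm_powR.
- move=> u; rewrite /F.
  have dut : is_derive u 1 (fun v : R => v - t) (1 - 0).
    exact: is_deriveB (id' u) (is_derive_cst t u 1).
  have dc := @is_derive1_comp R (fun v => `|v| `^ (g + 2)) (fun v => v - t) u _ _
    (dQ (u - t)) dut.
  have cst c := is_derive_cst (c : R) u (1 : R).
  have := is_deriveM (cst 2^-1)
    (is_deriveD (is_deriveM (is_deriveM (dP u) (cst t)) (cst (g + 1)^-1))
      (is_deriveD (is_deriveM (is_deriveM (cst (`|t| `^ g * t)) (id' u)) (cst (g + 1)^-1))
       (is_deriveM (is_deriveB dc (dQ u)) (cst ((g + 1) * (g + 2))^-1)))).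
  move=> D; apply: (is_derive_eq D); rewrite /GRing.scale/=.
  by field; rewrite g1 g2.
Qed.

End ifbm.

(** * Invertibility of the Brownian kernel matrix *)

Lemma telescope_bm (R : realType) (e : nat -> R) (n : nat) (i j : 'I_n) :
  \sum_(k < n | ((k <= i) && (k <= j))%N) (e k.+1 - e k) = e (minn i j).+1 - e 0%N.
Proof.
transitivity (\sum_(0 <= k < (minn i j).+1) (e k.+1 - e k)); last first.
  by rewrite telescope_sumr.
have le_n : ((minn i j).+1 <= n)%N by rewrite (leq_ltn_trans (geq_minl _ _)).
rewrite big_mkord (big_ord_widen _ (fun k => e k.+1 - e k) le_n).
by apply: eq_bigl => k; rewrite ltnS leq_min.
Qed.

(* The kernel matrix is L D L^T with L the lower triangular matrix of ones and D
   the diagonal matrix of increments. *)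
Lemma bm_kernel_mx_unit (R : realType) (n : nat) (ys : 'rV[R]_n) :
  (forall i, 0 < ys 0 i) -> (forall i j : 'I_n, (i < j)%N -> ys 0 i < ys 0 j) ->
  kernel_mx (@bm_kernel R) ys \in unitmx.
Proof.
move=> ys_gt0 ys_incr.
(* Prepending [e 0 = 0], the starting point of Brownian motion, shifts the indices by one and makes
   the first increment the first point. The default past the last point is never reached. *)
pose e k : R := if k is k'.+1 then oapp (ys 0) 0 (insub k') else 0.
have eE (i : 'I_n) : e i.+1 = ys 0 i by rewrite /= valK.
pose L := \matrix_(i < n, k < n) (if (k <= i)%N then 1 else 0 : R).
pose D := diag_mx (\row_(k < n) (e k.+1 - e k)).
have -> : kernel_mx (@bm_kernel R) ys = L *m D *m L^T.
  apply/matrixP => i j; rewrite /D mul_mx_diag !mxE.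
  under eq_bigr => k _ do rewrite !mxE.
  (* In entry (i, j) only the increments with k <= min(i, j) survive; they telescope to the smaller
     of the two points. *)
  transitivity (\sum_(k < n | ((k <= i) && (k <= j))%N) (e k.+1 - e k)).
    rewrite telescope_bm subr0 /bm_kernel; case: (ltngtP i j) => [ij|ji|/val_inj ->].
    - by rewrite eE min_l// ltW// ys_incr.
    - by rewrite eE min_r// ltW// ys_incr.
    - by rewrite eE minxx.
  rewrite [LHS]big_mkcond; apply: eq_bigr => k _.
  by case: (k <= i)%N; case: (k <= j)%N; rewrite /= ?(mul1r, mulr1, mul0r, mulr0).
have Ltrig : is_trig_mx L.
  by apply/is_trig_mxP => i j ij; rewrite mxE leqNgt ij.
have detL : \det L = 1.
  by rewrite det_trig// big1// => i _; rewrite mxE leqnn.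
(* The determinant is the product of the increments, which are all positive. *)
rewrite unitmxE !det_mulmx det_tr detL det_diag mul1r mulr1 unitfE.
apply/prodf_neq0 => -[[|k] kn] _; rewrite mxE subr_eq0.
  by rewrite (eE (Ordinal kn)) gt_eqF.
rewrite (eE (Ordinal kn)) (eE (Ordinal (ltnW kn))) gt_eqF//.
exact: ys_incr.
Qed.

(** * Posterior mean and variance from interpolation weights *)

Section posterior.
Variables (R : realType) (k : R -> R -> R) (f : R -> R) (n : nat).
Variables (ys : 'rV[R]_n) (y : R) (w : 'cV[R]_n).
Hypothesis k_sym : forall s t, k s t = k t s.
Hypothesis K_unit : kernel_mx k ys \in unitmx.
Hypothesis colE : kernel_col k ys y = kernel_mx k ys *m w.

(** Once w solves K w = k(xs, y), symmetry of K turns k(xs, y)^T K^-1 into w^T, so the inverse is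
    never computed. *)
Lemma kernel_col_weights :
  (kernel_col k ys y)^T *m invmx (kernel_mx k ys) = w^T.
Proof.
have K_sym : (kernel_mx k ys)^T = kernel_mx k ys.
  by apply/matrixP => i j; rewrite !mxE k_sym.
by rewrite colE trmx_mul K_sym mulmxK.
Qed.

Lemma posterior_meanE : posterior_mean k f ys y = (w^T *m data_col f ys) 0 0.
Proof. by rewrite /posterior_mean kernel_col_weights. Qed.

Lemma posterior_varE :
  posterior_var k ys y = k y y - (w^T *m kernel_col k ys y) 0 0.
Proof. by rewrite /posterior_var kernel_col_weights. Qed.

End posterior.

Section bm_leave_one_out.
Variables (R : realType) (f : R -> R) (n : nat) (ys : 'rV[R]_n) (t : R).
Variables j1 j2 : 'I_n.
Hypothesis ys_gt0 : forall i, 0 < ys 0 i.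
Hypothesis ys_incr : forall i j : 'I_n, (i < j)%N -> ys 0 i < ys 0 j.
Hypothesis t_gt : ys 0 j1 < t.
Hypothesis t_lt : t < ys 0 j2.
Hypothesis neighbours : forall i, ys 0 i <= ys 0 j1 \/ ys 0 j2 <= ys 0 i.

Let y1 := ys 0 j1.
Let y2 := ys 0 j2.
Let w1 := (y2 - t) / (y2 - y1).
Let w2 := (t - y1) / (y2 - y1).
Let w : 'cV[R]_n := w1 *: delta_mx j1 0 + w2 *: delta_mx j2 0.

Let y12 : y2 - y1 != 0.
Proof. by rewrite subr_eq0 gt_eqF// (lt_trans t_gt). Qed.

Let weights_tr (v : 'cV[R]_n) : (w^T *m v) 0 0 = w1 * v j1 0 + w2 * v j2 0.
Proof.
rewrite /w linearD/= !linearZ/= !trmx_delta mulmxDl -!scalemxAl -!rowE.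
by rewrite !mxE.
Qed.

Let bm_sym (s u : R) : bm_kernel s u = bm_kernel u s.
Proof. exact: minC. Qed.

(** No design point lies strictly between y1 and y2, so on [y1, y2] the function min(ys_i, .) is
    either the constant ys_i or the identity. Linear interpolation reproduces both at t. *)
Let bm_col : kernel_col (@bm_kernel R) ys t = kernel_mx (@bm_kernel R) ys *m w.
Proof.
rewrite /w mulmxDr -!scalemxAr -!colE; apply/matrixP => i j.
rewrite !mxE -/y1 -/y2 /bm_kernel.
have lt1 : y1 < t := t_gt; have lt2 : t < y2 := t_lt.
case: (neighbours i); rewrite -/y1 -/y2 => le_i.
  rewrite !min_l//; [|lra..].
  by rewrite -mulrDl /w1 /w2; field.
rewrite !min_r//; [|lra..].
by rewrite /w1 /w2; field.
Qed.

Lemma bm_posterior_mean :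
  posterior_mean (@bm_kernel R) f ys t =
  (y2 - t) / (y2 - y1) * f y1 + (t - y1) / (y2 - y1) * f y2.
Proof.
rewrite (posterior_meanE f bm_sym (bm_kernel_mx_unit ys_gt0 ys_incr) bm_col).
by rewrite weights_tr !mxE.
Qed.

Lemma bm_posterior_var :
  posterior_var (@bm_kernel R) ys t = (t - y1) * (y2 - t) / (y2 - y1).
Proof.
rewrite (posterior_varE bm_sym (bm_kernel_mx_unit ys_gt0 ys_incr) bm_col).
rewrite weights_tr !mxE /bm_kernel minxx -/y1 -/y2 min_l ?ltW// min_r ?ltW//.
by rewrite /w1 /w2; field.
Qed.

End bm_leave_one_out.

(** * Leave-one-out posterior at the interior points of a partition *)

Section interior_terms.
Variables (R : realType) (x : nat -> nat -> R) (T : R).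
Hypothesis x_partition : partition_seq T x.

Lemma partition_lt N i j : (i < j <= N)%N -> x N i < x N j.
Proof.
elim: j => // j IH /andP[]; rewrite ltnS => ij jN.
have N_gt0 : (0 < N)%N by case: N jN {IH}.
have [_ _ step] := x_partition N_gt0.
move: ij; rewrite leq_eqVlt => /predU1P[->|ij]; first exact: step.
by rewrite (lt_trans (IH _)) ?step// ij ltnW.
Qed.

Lemma partition_gt0 N i : (0 < i <= N)%N -> 0 < x N i.
Proof.
move=> /andP[i0 iN]; have [<- _ _] := x_partition (leq_trans i0 iN).
by apply: partition_lt; rewrite i0.
Qed.

Lemma partition_le_T N i : (0 < i <= N)%N -> x N i <= T.
Proof.
move=> /andP[i0 iN]; have [_ <- _] := x_partition (leq_trans i0 iN).
move: iN; rewrite leq_eqVlt => /predU1P[->//|iN].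
by rewrite ltW// partition_lt// iN leqnn.
Qed.

Lemma interior_posterior (f : R -> R) N (i : 'I_N) : (0 < i)%N -> (i.+1 < N)%N ->
  let a := spacing x N i in let b := spacing x N i.+1 in
  let ys := col' i (design x N) in let t := design x N 0 i in
  posterior_mean (@bm_kernel R) f ys t =
    b / (a + b) * f (x N i) + a / (a + b) * f (x N i.+2) /\
  posterior_var (@bm_kernel R) ys t = a * b / (a + b).
Proof.
move=> i_gt0 i_ltN a b ys t.
(* The design omits the point 0, so its entry of index [i] is [x N i.+1], with neighbours [x N i]
   and [x N i.+2]. *)
have tE : t = x N i.+1 by rewrite /t mxE.
have ysE j : ys 0 j = x N (lift i j).+1 by rewrite !mxE.
have ys_gt0 j : 0 < ys 0 j by rewrite ysE partition_gt0 // ltn_ord.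
have lift_lt (j k : 'I_N.-1) : (j < k)%N -> (lift i j < lift i k)%N.
  by rewrite /= /bump; lia.
have ys_incr (j k : 'I_N.-1) : (j < k)%N -> ys 0 j < ys 0 k.
  by move=> jk; rewrite !ysE partition_lt// ltnS lift_lt // ltn_ord.
(* In the full design the neighbours have indices i - 1 and i + 1. Both differ from [i], so they are
   values of [lift i], which maps indices of the reduced design to those of the full one. *)
have i1N : (i.-1 < N)%N by rewrite (leq_ltn_trans (leq_pred _)).
have [] := @unlift_some _ i (Ordinal i1N).
  by rewrite -val_eqE/=; lia.
move=> j1 /(congr1 val)/= j1E _.
have [] := @unlift_some _ i (Ordinal i_ltN).
  by rewrite -val_eqE/=; lia.
move=> j2 /(congr1 val)/= j2E _.
have y1E : ys 0 j1 = x N i by rewrite ysE/= -j1E prednK.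
have y2E : ys 0 j2 = x N i.+2 by rewrite ysE/= -j2E.
have t_gt : ys 0 j1 < t by rewrite tE y1E partition_lt// ltnSn/=.
have t_lt : t < ys 0 j2 by rewrite tE y2E partition_lt// ltnSn/=.
have nb j : ys 0 j <= ys 0 j1 \/ ys 0 j2 <= ys 0 j.
  have := neq_lift i j; rewrite -val_eqE/= neq_ltn => /orP[|] ij.
    right; rewrite y2E ysE.
    move: (ij); rewrite leq_eqVlt => /predU1P[/= <-//|ij2].
    by rewrite ltW// partition_lt// ltnS ij2 ltn_ord.
  left; rewrite y1E ysE; move: (ij); rewrite leq_eqVlt => /predU1P[/= ->//|ij2].
  by rewrite ltW// partition_lt// ij2 ltnW.
rewrite (bm_posterior_mean f ys_gt0 ys_incr t_gt t_lt nb).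
rewrite (bm_posterior_var ys_gt0 ys_incr t_gt t_lt nb) y1E y2E tE.
by split; rewrite /a /b /spacing; congr (_ / _ * _ + _ / _ * _) || congr (_ / _); ring.
Qed.

End interior_terms.

(** * Expectations of products and squared residuals *)

(** Integrability travels with the value because linearity of the expectation requires it. *)
Definition has_mean (d : measure_display) (Omega : measurableType d) (R : realType)
    (P : probability Omega R) (X : Omega -> R) (m : R) : Prop :=
  P.-integrable setT (EFin \o X) /\ expectation P X = m%:E.

Section has_mean.
Variables (d : measure_display) (Omega : measurableType d) (R : realType).
Variable (P : probability Omega R).

Lemma has_mean_ext X Y a b : X =1 Y -> a = b ->
  has_mean P X a -> has_mean P Y b.
Proof. by move=> /funext -> ->. Qed.

Lemma has_mean0 : has_mean P (fun=> 0) 0.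
Proof.
split; first exact: integrable0.
by rewrite unlock integral0.
Qed.

Lemma has_meanD X Y a b : has_mean P X a -> has_mean P Y b ->
  has_mean P (fun w => X w + Y w) (a + b).
Proof.
move=> [iX EX] [iY EY]; split; first exact: (integrableD measurableT iX iY).
rewrite unlock; under eq_integral do rewrite EFinD.
by rewrite integralD_EFin// EFinD -EX -EY unlock.
Qed.

Lemma has_meanZ c X a : has_mean P X a -> has_mean P (fun w => c * X w) (c * a).
Proof.
move=> [iX EX]; split; first exact: (integrableZl measurableT c iX).
rewrite unlock; under eq_integral do rewrite EFinM.
by rewrite integralZl// EFinM -EX unlock.
Qed.

Lemma has_mean_sum (I : Type) (r : seq I) (Q : pred I) (X : I -> Omega -> R)
    (a : I -> R) : (forall i, Q i -> has_mean P (X i) (a i)) ->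
  has_mean P (fun w => \sum_(i <- r | Q i) X i w) (\sum_(i <- r | Q i) a i).
Proof.
move=> XQ; elim: r => [|i r IH].
  apply: has_mean_ext has_mean0; last by rewrite big_nil.
  by move=> w; rewrite big_nil.
case Qi : (Q i).
  apply: has_mean_ext (has_meanD (XQ _ Qi) IH); last by rewrite big_cons Qi.
  by move=> w; rewrite big_cons Qi.
apply: has_mean_ext IH; last by rewrite big_cons Qi.
by move=> w; rewrite big_cons Qi.
Qed.

(** For centred variables the covariance is the mean of the product. Finite variances make X^2 and
    Y^2 integrable, and XY is then integrable because |XY| <= X^2 + Y^2. *)
Lemma has_mean_mul (X Y : {RV P >-> R}) (vX vY c : R) :
  expectation P X = 0%:E -> expectation P Y = 0%:E ->
  covariance P X X = vX%:E -> covariance P Y Y = vY%:E ->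
  covariance P X Y = c%:E -> has_mean P (fun w => X w * Y w) c.
Proof.
have covE (U V : {RV P >-> R}) : expectation P U = 0%:E ->
    expectation P V = 0%:E -> covariance P U V = expectation P (fun w => U w * V w).
  move=> EU EV; rewrite covariance.unlock EU EV; congr (expectation P _).
  by apply/funext => w; rewrite /GRing.mul/= !subr0.
have mM (U V : {RV P >-> R}) : measurable_fun setT (fun w => U w * V w).
  exact: measurable_realfun.measurable_funM.
have iS (U : {RV P >-> R}) v : expectation P U = 0%:E -> covariance P U U = v%:E ->
    P.-integrable setT (EFin \o (fun w => U w * U w)).
  move=> EU; rewrite covE// unlock => Ev; apply/integrableP; split.
    exact/measurable_realfun.measurable_EFinP/mM.
  under eq_integral => w _ do rewrite /= ger0_norm -?expr2 ?sqr_ge0// expr2.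
  by rewrite Ev ltry.
move=> EX EY VX VY CXY; split; last by rewrite -CXY covE.
apply: (le_integrable measurableT _ _
  (integrableD measurableT (iS _ _ EX VX) (iS _ _ EY VY))).
  exact/measurable_realfun.measurable_EFinP/mM.
move=> w _ /=; rewrite lee_fin -!expr2.
rewrite [leRHS]ger0_norm ?addr_ge0 ?sqr_ge0//.
have := sqr_ge0 (X w - Y w); have := sqr_ge0 (X w + Y w); rewrite ler_norml.
have := sqr_ge0 (X w); have := sqr_ge0 (Y w).
move=> ? ? ? ?; apply/andP; split; nra.
Qed.

End has_mean.

Lemma gaussian_process_moment (d : measure_display) (Omega : measurableType d)
    (R : realType) (P : probability Omega R) (D : set R) (kappa : R -> R -> R)
    (f : R -> {RV P >-> R}) (s t : R) :
  gaussian_process D (fun=> 0) kappa f -> D s -> D t ->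
  has_mean P (fun w => f s w * f t w) (kappa s t).
Proof.
move=> [_ E0 cov] Ds Dt.
by apply: (@has_mean_mul _ _ _ _ _ _ (kappa s s) (kappa t t)); rewrite ?E0// cov.
Qed.

Lemma has_mean_residual (d : measure_display) (Omega : measurableType d)
    (R : realType) (P : probability Omega R) (D : set R) (kappa : R -> R -> R)
    (f : R -> {RV P >-> R}) (r s t a b : R) :
  gaussian_process D (fun=> 0) kappa f -> D r -> D s -> D t ->
  has_mean P (fun w => (f s w - (a * f r w + b * f t w)) ^+ 2)
    (kappa s s + a ^+ 2 * kappa r r + b ^+ 2 * kappa t t
     - 2 * a * kappa s r - 2 * b * kappa s t + 2 * a * b * kappa r t).
Proof.
move=> gp Dr Ds Dt; have M x y := @gaussian_process_moment _ _ _ _ _ _ _ x y gp.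
apply: has_mean_ext
  (has_meanD (M s s Ds Ds) (has_meanD (has_meanZ (a ^+ 2) (M r r Dr Dr))
  (has_meanD (has_meanZ (b ^+ 2) (M t t Dt Dt))
  (has_meanD (has_meanZ (- (2 * a)) (M s r Ds Dr))
  (has_meanD (has_meanZ (- (2 * b)) (M s t Ds Dt))
   (has_meanZ (2 * a * b) (M r t Dr Dt))))))); last by ring.
by move=> w; ring.
Qed.

(** * Bounds on powers and the variance of the interpolation residual *)

Section powR_bounds.
Variable R : realType.
Implicit Types m M s p q delta : R.

(** Meant for the exponent al - 1, which is 2H - 1 when l = 0 and so can have either sign; for a
    negative one the endpoint bounds trade places. *)
Lemma powR_bounds m M s : 0 < m -> exists c C, 0 < c /\
  forall y, m <= y <= M -> c <= y `^ s <= C.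
Proof.
move=> m_gt0; case: (leP 0 s) => s0.
  exists (m `^ s), (M `^ s); split; first exact: powR_gt0.
  move=> y /andP[my yM]; have y0 := le_trans (ltW m_gt0) my.
  by rewrite !ge0_ler_powR ?nnegrE ?(le_trans y0 yM) ?(ltW m_gt0).
have [mM|Mm] := leP m M; last first.
  by exists 1, 1; split => // y /andP[my yM]; lra.
have M_gt0 := lt_le_trans m_gt0 mM.
exists (M `^ s), (m `^ s); split; first exact: powR_gt0.
move=> y /andP[my yM]; have y0 := lt_le_trans m_gt0 my.
have -> : s = - - s by rewrite opprK.
rewrite !(powRN _ (- s)) !lef_pV2 ?posrE ?powR_gt0//.
by rewrite !ge0_ler_powR ?nnegrE ?oppr_ge0 ?(ltW s0) ?(ltW M_gt0) ?(ltW y0) ?(ltW m_gt0).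
Qed.

Let powR_split p s : 0 < p -> p `^ s = p * p `^ (s - 1).
Proof.
move=> p0; rewrite -[s in LHS](subrKC 1) (@powRD _ p 1 (s - 1)) ?powRr1 ?ltW//.
by rewrite (gt_eqF p0) implybT.
Qed.

(** As p + q = 1, the expression equals p (p^(s-1) - 1) + q (q^(s-1) - 1). Since p and q are at most
    1 - delta and s < 1, each power is at least (1 - delta)^(s-1) > 1; it is at most delta^(s-1). *)
Lemma powR_split_lt1 s delta : 0 < delta < 1 -> s < 1 -> exists c C, 0 < c /\
  forall p q, delta <= p -> delta <= q -> p + q = 1 ->
    c <= p `^ s + q `^ s - 1 <= C.
Proof.
move=> /andP[d0 d1] s1.
have s1' : 0 < 1 - s by rewrite subr_gt0.
have d1' : 0 < 1 - delta by rewrite subr_gt0.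
pose A := (1 - delta) `^ (1 - s); pose B := delta `^ (1 - s).
have A0 : 0 < A by rewrite powR_gt0// subr_gt0.
have B0 : 0 < B by rewrite powR_gt0.
have A1 : A < 1.
  have e1 : (1 : R) `^ (1 - s) = 1 by rewrite powR1.
  rewrite -[ltRHS]e1 gt0_ltr_powR ?nnegrE//; lra.
have bnd p : delta <= p -> p <= 1 - delta -> A^-1 <= p `^ (s - 1) <= B^-1.
  move=> dp pd; have p0 := lt_le_trans d0 dp.
  have -> : s - 1 = - (1 - s) by rewrite opprB.
  rewrite powRN !lef_pV2 ?posrE ?powR_gt0//.
  by rewrite !ge0_ler_powR ?nnegrE ?(ltW s1') ?(ltW p0) ?(ltW d0)//; lra.
exists (A^-1 - 1); exists B^-1; split; first by rewrite subr_gt0 invf_gt1.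
move=> p q dp dq pq.
have /andP[p1 p2] : A^-1 <= p `^ (s - 1) <= B^-1 by apply: bnd => //; lra.
have /andP[q1 q2] : A^-1 <= q `^ (s - 1) <= B^-1 by apply: bnd => //; lra.
rewrite !(powR_split s) ?(lt_le_trans d0)//.
have p0 := lt_le_trans d0 dp; have q0 := lt_le_trans d0 dq.
move: p1 p2 q1 q2; move: (p `^ _) (q `^ _) (A^-1) (B^-1) => P Q A' B' *.
have -> : q = 1 - p by lra.
by apply/andP; split; nra.
Qed.

(** Here the expression is p (1 - p^(s-1)) + q (1 - q^(s-1)), and s > 1 makes each power at most (1
    - delta)^(s-1) < 1. *)
Lemma powR_split_gt1 s delta : 0 < delta < 1 -> 1 < s -> exists c C, 0 < c /\
  forall p q, delta <= p -> delta <= q -> p + q = 1 ->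
    c <= 1 - p `^ s - q `^ s <= C.
Proof.
move=> /andP[d0 d1] s1.
have s1' : 0 < s - 1 by rewrite subr_gt0.
pose A := (1 - delta) `^ (s - 1).
have A1 : A < 1.
  have e1 : (1 : R) `^ (s - 1) = 1 by rewrite powR1.
  rewrite -[ltRHS]e1 gt0_ltr_powR ?nnegrE//; lra.
have bnd p : delta <= p -> p <= 1 - delta -> 0 <= p `^ (s - 1) <= A.
  move=> dp pd; have p0 := lt_le_trans d0 dp.
  by rewrite powR_ge0 ge0_ler_powR ?nnegrE ?(ltW s1') ?(ltW p0)//; lra.
exists (1 - A), 1; split; first by rewrite subr_gt0.
move=> p q dp dq pq.
have /andP[p1 p2] : 0 <= p `^ (s - 1) <= A by apply: bnd => //; lra.
have /andP[q1 q2] : 0 <= q `^ (s - 1) <= A by apply: bnd => //; lra.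
rewrite !(powR_split s) ?(lt_le_trans d0)//.
have p0 := lt_le_trans d0 dp; have q0 := lt_le_trans d0 dq.
move: p1 p2 q1 q2; move: (p `^ _) (q `^ _) A A1 {bnd} => P Q A *.
have -> : q = 1 - p by lra.
by apply/andP; split; nra.
Qed.

(** Since s = q r + p t with p + q = 1, the terms in u and v cancel. As a = (a + b) p and b = (a +
    b) q, the rest of the numerator is -2 rho p q (a + b)^al (p^(al-1) + q^(al-1) - 1), and the
    denominator is (a + b) p q. *)
Lemma second_difference (kappa : R -> R -> R) (u v : R -> R) (rho al r a b : R) :
  al != 0 -> 0 < r -> 0 < a -> 0 < b ->
  (forall s t, 0 < s -> 0 < t ->
    kappa s t = u s + u t + (v s * t + v t * s) + rho * `|s - t| `^ al) ->
  let s := r + a in let t := r + a + b in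
  let p := a / (a + b) in let q := b / (a + b) in
  (kappa s s + q ^+ 2 * kappa r r + p ^+ 2 * kappa t t
     - 2 * q * kappa s r - 2 * p * kappa s t + 2 * q * p * kappa r t)
    / (a * b / (a + b)) =
  (a + b) `^ (al - 1) * (- 2 * rho * (p `^ (al - 1) + q `^ (al - 1) - 1)).
Proof.
move=> al0 r0 a0 b0 kE s t p q.
have ab0 : 0 < a + b by exact: addr_gt0.
have s0 : 0 < s by exact: addr_gt0.
have t0 : 0 < t by exact: addr_gt0.
have p0 : 0 < p by exact: divr_gt0.
have q0 : 0 < q by exact: divr_gt0.
have abE : a * b / (a + b) = (a + b) * (p * q).
  by rewrite /p /q; field; rewrite gt_eqF.
have qE : q = 1 - p by rewrite /p /q; field; rewrite gt_eqF.
have aE : a = (a + b) * p by rewrite /p; field; rewrite gt_eqF.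
have bE : b = (a + b) * q by rewrite /q; field; rewrite gt_eqF.
have sr : `|s - r| = a by rewrite (_ : s - r = a) ?gtr0_norm// /s; ring.
have st : `|s - t| = b by rewrite distrC (_ : t - s = b) ?gtr0_norm// /s /t; ring.
have rt : `|r - t| = a + b by rewrite distrC (_ : t - r = a + b) ?gtr0_norm// /t; ring.
have sE : s = r + (a + b) * p by rewrite -aE.
have tE : t = r + (a + b) by rewrite /t addrA.
(* On the diagonal |0|^al vanishes by [al0]; at al = 0 the power would be 1. *)
rewrite !kE// sr st rt !subrr normr0 powR0// abE.
clearbody p q s t.
rewrite [in a `^ al]aE [in b `^ al]bE !powRM ?(ltW ab0) ?(ltW p0) ?(ltW q0)//.
rewrite !(powR_split al)//.
move: ((a + b) `^ (al - 1)) (p `^ (al - 1)) (q `^ (al - 1)) => E P Q.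
move: (u r) (u s) (u t) (v r) (v s) (v t) => ur us ut vr vs vt.
have D0 := lt0r_neq0 ab0; have p0' := lt0r_neq0 p0; have q0' := lt0r_neq0 q0.
move: D0 p0' q0'; rewrite sE tE qE; move: (a + b) => D D0 p0' q0'.
by field; rewrite D0 p0' q0'.
Qed.

End powR_bounds.

(** * Spacings of a quasi-uniform partition *)

Section spacings.
Variables (R : realType) (x : nat -> nat -> R) (T : R).
Hypothesis x_partition : partition_seq T x.

Lemma spacing_gt0 N n : (n < N)%N -> 0 < spacing x N n.
Proof.
by move=> nN; rewrite subr_gt0; apply: (partition_lt x_partition); rewrite ltnSn.
Qed.

Lemma quasi_uniform_spacing : quasi_uniform x -> exists2 C, 1 <= C &
  forall N n m, (n < N)%N -> (m < N)%N -> spacing x N n <= C * spacing x N m.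
Proof.
move=> [C C1 supC]; exists C => // N n m nN mN.
have N0 : (0 < N)%N by exact: leq_ltn_trans nN.
have min_gt0 : 0 < min_spacing x N.
  by apply: lt_bigmin => [|i _]; exact: spacing_gt0.
have : ((max_spacing x N / min_spacing x N)%:E <= C%:E)%E.
  by rewrite -supC; apply: ereal_sup_ubound; exists N.
rewrite lee_fin ler_pdivrMr// => maxC.
have max_n : spacing x N n <= max_spacing x N.
  exact: (le_bigmax _ (fun i : 'I_N => spacing x N i) (Ordinal nN)).
apply: (le_trans max_n); apply: (le_trans maxC).
rewrite ler_pM2l ?(lt_le_trans ltr01)//.
exact: (bigmin_le _ (Ordinal mN) (fun i : 'I_N => spacing x N i)).
Qed.

(** The N spacings add up to T and each is within a factor C of the n-th; summing these comparisons
    gives both bounds. *)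
Lemma spacing_bounds C N n : 1 <= C -> (n < N)%N ->
  (forall m k, (m < N)%N -> (k < N)%N -> spacing x N m <= C * spacing x N k) ->
  T / C <= spacing x N n * N%:R <= C * T.
Proof.
move=> C1 nN unif.
have N0 : (0 < N)%N by exact: leq_ltn_trans nN.
have C0 : 0 < C by exact: lt_le_trans C1.
have TE : T = \sum_(m < N) spacing x N m.
  have [x0 xT _] := x_partition N0.
  rewrite -(big_mkord xpredT (spacing x N)) telescope_sumr//.
  by rewrite x0 xT subr0.
have cst (c : R) : \sum_(m < N) c = c * N%:R.
  by rewrite sumr_const card_ord mulr_natr.
rewrite ler_pdivrMr// mulrAC -!cst TE mulr_sumr.
by apply/andP; split; apply: ler_sum => m _; rewrite ?(mulrC _ C) unif.
Qed.

End spacings.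

(** * Two-sided bounds for the expected estimator *)

Lemma sum_interior (R : realType) (N : nat) (c : R) : (2 <= N)%N ->
  \sum_(i < N | ((0 < i) && (i.+1 < N))%N) c = (N - 2)%:R * c.
Proof.
case: N => [//|[//|n]] _; rewrite big_mkcond big_ord_recl big_ord_recr/=.
rewrite ltnn add0r addr0 subSS subSS subn0 mulr_natl.
rewrite (eq_bigr (fun=> c)) ?sumr_const ?card_ord// => i _.
by rewrite /= /bump !ltnS ltn_ord.
Qed.

Lemma fbm_kernelE (R : realType) (H : R) (s t : R) : fbm_kernel H s t =
  2^-1 * `|s| `^ (2 * H) + 2^-1 * `|t| `^ (2 * H) + (0 * t + 0 * s)
  + (- 2^-1) * `|s - t| `^ (2 * H).
Proof. by rewrite /fbm_kernel; ring. Qed.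

(** Serves both values of l, which differ in how the bound on p and q is met: rho and p^(al-1) +
    q^(al-1) - 1 have opposite signs, rho being negative for l = 0 and positive for l = 1. *)
Lemma ebigTheta_ICV (R : realType) (d : measure_display) (Omega : measurableType d)
    (P : probability Omega R) (T : R) (x : nat -> nat -> R)
    (kappa : R -> R -> R) (f : R -> {RV P >-> R}) (u v : R -> R) (rho al : R) :
  0 < T -> partition_seq T x -> quasi_uniform x ->
  gaussian_process `[0, T] (fun=> 0) kappa f ->
  al != 0 ->
  (forall s t, 0 < s -> 0 < t ->
    kappa s t = u s + u t + (v s * t + v t * s) + rho * `|s - t| `^ al) ->
  (forall delta, 0 < delta < 1 -> exists c C, 0 < c /\
    forall p q, delta <= p -> delta <= q -> p + q = 1 ->
      c <= - 2 * rho * (p `^ (al - 1) + q `^ (al - 1) - 1) <= C) ->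
  ebigTheta (fun N : nat => expectation P
      (fun w => sigma2_ICV (@bm_kernel R) (fun t => f t w) (design x N)))
    (fun N => N%:R `^ (1 - al)).
Proof.
move=> T0 xP xQ gp al0 kE split_bounds.
have [C C1 unif] := quasi_uniform_spacing xP xQ.
have C0 : 0 < C by exact: lt_le_trans C1.
(* From a <= C b and b <= C a, both a / (a + b) and b / (a + b) are at least 1 / (1 + C). *)
have del01 : 0 < (1 + C)^-1 < 1.
  by rewrite invr_gt0 addr_gt0//= invf_lt1 ?addr_gt0// ltrDl.
have [cG [CG [cG0 Gbnd]]] := split_bounds _ del01.
(* By [spacing_bounds] for two adjacent spacings, N (a + b) lies between 2 T / C and 2 C T. *)
have m0 : 0 < 2 * (T / C) by rewrite mulr_gt0// divr_gt0.
have [cD [CD [cD0 Dbnd]]] := @powR_bounds R _ (2 * (C * T)) (al - 1) m0.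
pose a N n := spacing x N n; pose b N n := spacing x N n.+1.
pose D N n := a N n + b N n.
pose G N n := - 2 * rho * ((a N n / D N n) `^ (al - 1) + (b N n / D N n) `^ (al - 1) - 1).
pose mean (N : nat) := N%:R^-1 * \sum_(i < N | ((0 < i) && (i.+1 < N))%N)
  (D N i `^ (al - 1) * G N i).
have meanE N :
    has_mean P (fun w => sigma2_ICV (@bm_kernel R) (fun t => f t w) (design x N))
      (mean N).
  apply: has_meanZ; apply: has_mean_sum => i /andP[i0 iN].
  have a0 : 0 < a N i by exact: spacing_gt0 xP _ _ _.
  have b0 : 0 < b N i by exact: spacing_gt0 xP _ _ _.
  have inD n : (n <= N)%N -> (0 < n)%N -> `[0, T]%classic (x N n).
    move=> nN n0; have n0N : (0 < n <= N)%N by rewrite n0.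
    by rewrite /= in_itv/= (ltW (partition_gt0 xP n0N)) (partition_le_T xP n0N).
  have gpM := @has_mean_residual _ _ _ _ _ _ _ _ _ _ (b N i / D N i) (a N i / D N i) gp
    (inD i (ltnW (ltnW iN)) i0) (inD i.+1 (ltnW iN) isT) (inD i.+2 iN isT).
  apply: has_mean_ext (has_meanZ ((a N i * b N i / D N i)^-1) gpM).
    move=> w; have [-> ->] := interior_posterior xP (fun t => f t w) i0 iN.
    by rewrite mxE mulrC.
  have x1 : x N i.+1 = x N i + a N i by rewrite /a /spacing; ring.
  have x2 : x N i.+2 = x N i + a N i + b N i by rewrite /a /b /spacing; ring.
  have xi0 : 0 < x N i by rewrite (partition_gt0 xP)// i0 ltnW// ltnW.
  by rewrite mulrC x1 x2 (second_difference al0 xi0 a0 b0 kE).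
have termB N (i : 'I_N) : ((0 < i) && (i.+1 < N))%N ->
    cD * cG * N%:R `^ (1 - al) <= D N i `^ (al - 1) * G N i
      <= CD * CG * N%:R `^ (1 - al).
  move=> /andP[i0 iN].
  have N0 : 0 < N%:R :> R by rewrite ltr0n (leq_ltn_trans _ iN).
  have a0 : 0 < a N i by exact: spacing_gt0 xP _ _ _.
  have b0 : 0 < b N i by exact: spacing_gt0 xP _ _ _.
  have D0 : 0 < D N i by exact: addr_gt0.
  have /andP[a1 a2] := spacing_bounds xP C1 (ltnW iN) (unif N).
  have /andP[b1 b2] := spacing_bounds xP C1 iN (unif N).
  have ab := unif N i i.+1 (ltnW iN) iN.
  have ba := unif N i.+1 i iN (ltnW iN).
  have /andP[G1 G2] : cG <= G N i <= CG.
    apply: Gbnd.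
    - rewrite ler_pdivlMr// ler_pdivrMl ?addr_gt0// mulrDl mul1r /D lerD2l.
      exact: ba.
    - rewrite ler_pdivlMr// ler_pdivrMl ?addr_gt0// mulrDl mul1r.
      rewrite /D [a N i + _]addrC lerD2l.
      exact: ab.
    - by rewrite -mulrDl divff// gt_eqF.
  have DE : D N i `^ (al - 1) = (D N i * N%:R) `^ (al - 1) * N%:R `^ (1 - al).
    rewrite powRM ?(ltW D0) ?(ltW N0)// -mulrA -powRD.
      by rewrite (_ : al - 1 + (1 - al) = 0) ?powRr0 ?mulr1 //; ring.
    by rewrite (gt_eqF N0) implybT.
  have /andP[D1 D2] : cD <= (D N i * N%:R) `^ (al - 1) <= CD.
    by apply: Dbnd; rewrite /D /a /b mulrDl; lra.
  have G0 := lt_le_trans cG0 G1.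
  rewrite DE [_ * G N i]mulrAC !ler_pM2r ?powR_gt0//.
  by rewrite !ler_pM ?powR_ge0 ?(ltW cD0) ?(ltW cG0) ?(ltW G0).
(* For N >= 3 the N - 2 interior terms make up at least a third of N, whence the factor 1/3. *)
have thetaE N : (3 <= N)%N ->
    3^-1 * (cD * cG) * N%:R `^ (1 - al) <= mean N <= CD * CG * N%:R `^ (1 - al).
  move=> N3; have N0 : 0 < N%:R :> R by rewrite ltr0n (leq_trans _ N3).
  have N2 : (2 <= N)%N by exact: ltnW.
  have lo : (N - 2)%:R * (cD * cG * N%:R `^ (1 - al)) <=
      \sum_(i < N | ((0 < i) && (i.+1 < N))%N) (D N i `^ (al - 1) * G N i).
    by rewrite -sum_interior//; apply: ler_sum => i /termB/andP[].
  have hi : \sum_(i < N | ((0 < i) && (i.+1 < N))%N) (D N i `^ (al - 1) * G N i)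
      <= (N - 2)%:R * (CD * CG * N%:R `^ (1 - al)).
    by rewrite -sum_interior//; apply: ler_sum => i /termB/andP[].
  have E0 : 0 < N%:R `^ (1 - al) :> R by exact: powR_gt0.
  (* The upper constants come without a sign. Index 1, the value of [Ordinal N2], is interior, and
     the positive lower bound on its term forces their product to be positive. *)
  have CDG0 : 0 < CD * CG.
    have /termB/andP[lo' hi'] : ((0 < Ordinal N2) && ((Ordinal N2).+1 < N))%N by [].
    by rewrite -(pmulr_lgt0 _ E0) (lt_le_trans _ (le_trans lo' hi'))// !mulr_gt0.
  rewrite /mean ler_pdivlMl// ler_pdivrMl//; apply/andP; split.
    apply: le_trans lo.
    rewrite -[3^-1 * (cD * cG) * _]mulrA [leLHS]mulrA.
    apply: ler_wpM2r.
      by rewrite ltW// !mulr_gt0.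
    rewrite natrB//; have : 3 <= N%:R :> R by rewrite ler_nat.
    by lra.
  apply: (le_trans hi); rewrite ler_wpM2r ?ler_nat ?leq_subr//.
  by rewrite ltW// mulr_gt0.
(* This choice of C makes c <= C hold whatever the sign of [CD * CG]. *)
exists (3^-1 * (cD * cG)); exists (3^-1 * (cD * cG) + `|CD * CG|); split.
- by rewrite !mulr_gt0.
- by rewrite lerDl.
- exists 3%N => // N /= /thetaE/andP[lo hi]; have [_ ->] := meanE N.
  rewrite !lee_fin lo (le_trans hi)// ler_wpM2r ?powR_ge0//.
  by rewrite (le_trans (ler_norm _))// lerDr !mulr_ge0// ltW.
Qed.

Theorem theorem15 (R : realType) (d : measure_display) (Omega : measurableType d)
    (P : probability Omega R) (T : R) (x : nat -> nat -> R)
    (l : 'I_2) (H : R) (f : R -> {RV P >-> R})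
    (T_gt0 : 0 < T)
    (x_partition : partition_seq T x) (x_quasi_uniform : quasi_uniform x)
    (H_gt0 : 0 < H) (H_lt1 : H < 1)
    (f_gp : gaussian_process `[0, T] (fun=> 0) (hurst_kernel l H) f) :
  let E_ICV := fun N : nat =>
    expectation P
      (fun w => sigma2_ICV (@bm_kernel R) (fun t => f t w) (design x N)) in
  [/\ ebigTheta E_ICV
        (fun N => N%:R `^ (1 - Num.min (2 * ((val l)%:R + H)) 4)),
      val l = 0%N -> ebigTheta E_ICV (fun N => N%:R `^ (1 - 2 * H))
    & val l = 1%N -> ebigTheta E_ICV (fun N => N%:R `^ (- 1 - 2 * H))].
Proof.
move=> E_ICV.
have g0 : 0 < 2 * H by rewrite mulr_gt0.
case: l f_gp => [[|[|//]] l2] /= gp; rewrite minEle.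
(* Here al = 2H and rho = -1/2, so -2 rho = 1 and the exponent al - 1 = 2H - 1 is below 1. *)
- have theta : ebigTheta E_ICV (fun N => N%:R `^ (1 - 2 * H)).
    apply: (ebigTheta_ICV (u := fun s => 2^-1 * `|s| `^ (2 * H)) (v := fun=> 0)
      T_gt0 x_partition x_quasi_uniform gp (lt0r_neq0 g0)).
      by move=> s t _ _; exact: fbm_kernelE.
    move=> delta delta01; have s1 : 2 * H - 1 < 1 by lra.
    have [c [C [c0 bnd]]] := powR_split_lt1 delta01 s1.
    exists c; exists C; split=> // p q dp dq pq.
    by rewrite (_ : - 2 * - 2^-1 = 1) ?mul1r ?bnd//; lra.
  have le4 : 2 * (0%:R + H) <= 4 by rewrite add0r; lra.
  by rewrite le4 add0r.
(* Here al = 2H + 2 and rho = c0 / 2; the exponent al - 1 = 2H + 1 exceeds 1, and the negative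
   factor -2 rho reverses the sign. *)
- pose c0 := ((2 * H + 1) * (2 * H + 2))^-1.
  have c0_gt0 : 0 < c0 by rewrite invr_gt0 mulr_gt0// addr_gt0.
  have al0 : 2 * H + 2 != 0 by rewrite gt_eqF// addr_gt0.
  have theta : ebigTheta E_ICV (fun N => N%:R `^ (1 - (2 * H + 2))).
    apply: (ebigTheta_ICV (u := fun s => - 2^-1 * c0 * `|s| `^ (2 * H + 2))
      (v := fun s => 2^-1 * (`|s| `^ (2 * H) * s / (2 * H + 1))) (rho := 2^-1 * c0)
      T_gt0 x_partition x_quasi_uniform gp al0).
      move=> s t s0 t0; rewrite /hurst_kernel /= ifbm_kernelE// /c0; field.
      by rewrite !gt_eqF// addr_gt0.
    move=> delta delta01; have s1 : 1 < 2 * H + 2 - 1 by lra.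
    have [c [C [c_gt0 bnd]]] := powR_split_gt1 delta01 s1.
    exists (c0 * c); exists (c0 * C); split=> [|p q dp dq pq]; first exact: mulr_gt0.
    set Z := (X in _ <= X <= _).
    have -> : Z = c0 * (1 - p `^ (2 * H + 2 - 1) - q `^ (2 * H + 2 - 1)).
      by rewrite /Z; field.
    by rewrite !ler_pM2l// bnd.
  (* Since H < 1, the minimum is its first argument even for l = 1. *)
  have le4 : 2 * (1%:R + H) <= 4 by lra.
  rewrite le4; split=> //.
  + by rewrite mulrDr mulr1 [2 + _]addrC.
  + by move=> _; rewrite (_ : - 1 - 2 * H = 1 - (2 * H + 2)) //; lra.
Qed.
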